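(* Let $\mathbb V=\{\sum_{i=1}^n\alpha_i\cdot\lambda x_i.\mathbf t_i+\sum_{j=n+1}^m\lambda x_j.\mathbf t_j \mid \lambda x_i.\mathbf t_i\neq\lambda x_j.\mathbf t_j \text{ for all } i,j\}$ and let $\mathsf{NF}$ be the set of terms in normal form (terms $\mathbf t$ with no $\mathbf t'$ such that $\mathbf t\to\mathbf t'$). If $\vdash\mathbf t:T$ is derivable in $\lambda^{\mathrm{vec}}_{\mathrm R}$ with the empty context and $\mathbf t\in\mathsf{NF}$, then $\mathbf t\in\mathbb V$.
   Context: Fix a commutative ring $(\mathsf S,+,\times)$ of scalars. Terms: $\mathbf t ::= x\mid \lambda x.\mathbf t\mid (\mathbf t)\,\mathbf t\mid \alpha\cdot\mathbf t\mid \mathbf t+\mathbf t$, $\alpha\in\mathsf S$. Basis terms: $\mathbf b ::= x\mid\lambda x.\mathbf t$. The one-step reduction $\to$ is the closure under the contexts $\alpha\cdot[-]$, $\mathbf u+[-]$, $(\mathbf u)\,[-]$, $([-])\,\mathbf u$, $\lambda x.[-]$ of: $1\cdot\mathbf t\to\mathbf t$; $\alpha\cdot(\beta\cdot\mathbf t)\to(\alpha\times\beta)\cdot\mathbf t$; $\alpha\cdot(\mathbf t+\mathbf r)\to\alpha\cdot\mathbf t+\alpha\cdot\mathbf r$; $\alpha\cdot\mathbf t+\beta\cdot\mathbf t\to(\alpha+\beta)\cdot\mathbf t$; $\alpha\cdot\mathbf t+\mathbf t\to(\alpha+1)\cdot\mathbf t$; $\mathbf t+\mathbf t\to(1+1)\cdot\mathbf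 t$; $(\mathbf t+\mathbf r)\,\mathbf u\to(\mathbf t)\,\mathbf u+(\mathbf r)\,\mathbf u$; $(\mathbf t)\,(\mathbf r+\mathbf u)\to(\mathbf t)\,\mathbf r+(\mathbf t)\,\mathbf u$; $(\alpha\cdot\mathbf t)\,\mathbf r\to\alpha\cdot(\mathbf t)\,\mathbf r$; $(\mathbf t)\,(\alpha\cdot\mathbf r)\to\alpha\cdot(\mathbf t)\,\mathbf r$; $(\lambda x.\mathbf t)\,\mathbf b\to\mathbf t[\mathbf b/x]$ for basis terms $\mathbf b$. Types: general $T::=U\mid\alpha\cdot T\mid T+T\mid\mathbb X$, unit $U::=X\mid U\to T\mid\forall X.U\mid\forall\mathbb X.U$ ($X$ unit type variables, $\mathbb X$ general type variables). $\equiv$ is the smallest congruence with $1\cdot T\equiv T$, $\alpha\cdot(\beta\cdot T)\equiv(\alpha\times\beta)\cdot T$, $\alpha\cdot T+\alpha\cdot R\equiv\alpha\cdot(T+R)$, $\alpha\cdot T+\beta\cdot T\equiv(\alpha+\beta)\cdot T$, $T+R\equiv R+T$, $T+(R+S)\equiv(T+R)+S$. In $T[A/X]$, $A$ is unit when $X$ is a unit variable. Contexts are finite sets of $x:U$ with $U$ unit. Typing rules: (ax) $\Gamma,x:U\vdash x:U$; ($\equiv$) from $\Gamma\vdash\mathbf t:T$, $R\equiv T$ infer $\Gamma\vdash\mathbf t:R$; ($\to_I$) from $\Gamma,x:U\vdash\mathbf t:T$ infer $\Gamma\vdash\lambda x.\mathbf t:U\to T$; ($\to_E$) from $\Gamma\vdash\mathbf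 t:\sum_{i=1}^n\alpha_i\cdot\forall\vec X.(U\to T_i)$ and $\Gamma\vdash\mathbf r:\sum_{j=1}^m\beta_j\cdot U[\vec A_j/\vec X]$ infer $\Gamma\vdash(\mathbf t)\,\mathbf r:\sum_{i}\sum_{j}(\alpha_i\times\beta_j)\cdot T_i[\vec A_j/\vec X]$; ($\forall_I$) from $\Gamma\vdash\mathbf t:\sum_i\alpha_i\cdot U_i$, $X\notin FV(\Gamma)$ infer $\Gamma\vdash\mathbf t:\sum_i\alpha_i\cdot\forall X.U_i$; ($\forall_E$) from $\Gamma\vdash\mathbf t:\sum_i\alpha_i\cdot\forall X.U_i$ infer $\Gamma\vdash\mathbf t:\sum_i\alpha_i\cdot U_i[A/X]$; ($+_I$) from $\Gamma\vdash\mathbf t:T$, $\Gamma\vdash\mathbf r:R$ infer $\Gamma\vdash\mathbf t+\mathbf r:T+R$; ($1_E$) from $\Gamma\vdash1\cdot\mathbf t:T$ infer $\Gamma\vdash\mathbf t:T$; ($S$) from $\Gamma\vdash\mathbf t:T_i$ for all $i\in\{1,\dots,n\}$ infer $\Gamma\vdash(\sum_i\alpha_i)\cdot\mathbf t:\sum_i\alpha_i\cdot T_i$.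
   Formalization: Terms are taken modulo associativity and commutativity of +: reduction, typing, membership in V and ''≠'' all respect this; on plain syntax trees the claim fails, e.g. for (λx.x)(λx.x) + λy.λz.y, whose left summand the context u+[-] cannot reduce. *)

(* Defs.v *)
From HB Require Import structures.
From mathcomp Require Import all_boot all_algebra.

Set Implicit Arguments.
Unset Strict Implicit.
Unset Printing Implicit Defensive.

Local Open Scope ring_scope.

(* F 0 + ... + F n for a binary constructor without neutral element: the
   calculus has neither a zero term nor a zero type, so every sum occurring in
   it has at least one summand. The bracketing is immaterial, both on types
   (by [teq]) and on terms (by [ac]). *)
Fixpoint sum1 (A : Type) (op : A -> A -> A) (n : nat) : ('I_n.+1 -> A) -> A :=
  match n with
  | 0 => fun F => F ord0
  | n'.+1 => fun F => op (F ord0) (sum1 op (fun i : 'I_n'.+1 => F (lift ord0 i)))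
  end.

(* Lifting of a renaming of de Bruijn indices under one binder. *)
Definition upr (f : nat -> nat) (n : nat) : nat :=
  if n is n'.+1 then (f n').+1 else 0%N.

Inductive term (S : comPzRingType) : Type :=
| Var of nat
| Lam of term S
| App of term S & term S
| Scal of S & term S
| Add of term S & term S.
Arguments Var {S}.

Definition basis (S : comPzRingType) (t : term S) : bool :=
  match t with Var _ | Lam _ => true | _ => false end.

Fixpoint tren (S : comPzRingType) (f : nat -> nat) (t : term S) : term S :=
  match t with
  | Var n => Var (f n)
  | Lam u => Lam (tren (upr f) u)
  | App u v => App (tren f u) (tren f v)
  | Scal a u => Scal a (tren f u)
  | Add u v => Add (tren f u) (tren f v)
  end.

Definition tup (S : comPzRingType) (s : nat -> term S) (n : nat) : term S :=
  if n is n'.+1 then tren succn (s n') else Var 0.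

Fixpoint tsubst (S : comPzRingType) (s : nat -> term S) (t : term S) : term S :=
  match t with
  | Var n => s n
  | Lam u => Lam (tsubst (tup s) u)
  | App u v => App (tsubst s u) (tsubst s v)
  | Scal a u => Scal a (tsubst s u)
  | Add u v => Add (tsubst s u) (tsubst s v)
  end.

Definition tsubst0 (S : comPzRingType) (b t : term S) : term S :=
  tsubst (fun n => if n is n'.+1 then Var n' else b) t.

(* Terms are taken modulo associativity and commutativity of +; [ac] is equality
   of terms, and reduction, typing and membership in [values] respect it. *)
Inductive ac (S : comPzRingType) : term S -> term S -> Prop :=
| ac_refl t : ac t t
| ac_sym t u : ac t u -> ac u t
| ac_trans t u v : ac t u -> ac u v -> ac t v
| ac_addC t u : ac (Add t u) (Add u t)
| ac_addA t u v : ac (Add t (Add u v)) (Add (Add t u) v)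
| ac_Lam t t' : ac t t' -> ac (Lam t) (Lam t')
| ac_App t t' u u' : ac t t' -> ac u u' -> ac (App t u) (App t' u')
| ac_Scal a t t' : ac t t' -> ac (Scal a t) (Scal a t')
| ac_Add t t' u u' : ac t t' -> ac u u' -> ac (Add t u) (Add t' u').

Inductive step (S : comPzRingType) : term S -> term S -> Prop :=
| step_one t : step (Scal 1 t) t
| step_scal_scal a b t : step (Scal a (Scal b t)) (Scal (a * b) t)
| step_scal_add a t r : step (Scal a (Add t r)) (Add (Scal a t) (Scal a r))
| step_factor a b t : step (Add (Scal a t) (Scal b t)) (Scal (a + b) t)
| step_factor1 a t : step (Add (Scal a t) t) (Scal (a + 1) t)
| step_factor11 t : step (Add t t) (Scal (1 + 1) t)
| step_app_addl t r u : step (App (Add t r) u) (Add (App t u) (App r u))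
| step_app_addr t r u : step (App t (Add r u)) (Add (App t r) (App t u))
| step_app_scall a t r : step (App (Scal a t) r) (Scal a (App t r))
| step_app_scalr a t r : step (App t (Scal a r)) (Scal a (App t r))
| step_beta t b : basis b -> step (App (Lam t) b) (tsubst0 b t)
| step_ctx_scal a t t' : step t t' -> step (Scal a t) (Scal a t')
| step_ctx_add u t t' : step t t' -> step (Add u t) (Add u t')
| step_ctx_appr u t t' : step t t' -> step (App u t) (App u t')
| step_ctx_appl u t t' : step t t' -> step (App t u) (App t' u)
| step_ctx_lam t t' : step t t' -> step (Lam t) (Lam t').

Definition red (S : comPzRingType) (t t' : term S) : Prop :=
  exists s s', [/\ ac t s, step s s' & ac s' t'].

Definition normal_form (S : comPzRingType) (t : term S) : Prop :=
  ~ exists t', red t t'.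

(* De Bruijn notation with two independent index spaces, one for the unit type
   variables and one for the general type variables: [UAllU] binds index 0 of
   the former, [UAllG] index 0 of the latter. *)
Inductive gtype (S : comPzRingType) : Type :=
| GUnit of utype S
| GScal of S & gtype S
| GAdd of gtype S & gtype S
| GVar of nat
with utype (S : comPzRingType) : Type :=
| UVar of nat
| UArr of utype S & gtype S
| UAllU of utype S
| UAllG of utype S.
Arguments GVar {S}.
Arguments UVar {S}.

Fixpoint gren (S : comPzRingType) (fu fg : nat -> nat) (T : gtype S) : gtype S :=
  match T with
  | GUnit U => GUnit (uren fu fg U)
  | GScal a R => GScal a (gren fu fg R)
  | GAdd R R' => GAdd (gren fu fg R) (gren fu fg R')
  | GVar n => GVar (fg n)
  end
with uren (S : comPzRingType) (fu fg : nat -> nat) (U : utype S) : utype S :=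
  match U with
  | UVar n => UVar (fu n)
  | UArr V T => UArr (uren fu fg V) (gren fu fg T)
  | UAllU V => UAllU (uren (upr fu) fg V)
  | UAllG V => UAllG (uren fu (upr fg) V)
  end.

Definition upU_u (S : comPzRingType) (su : nat -> utype S) (n : nat) : utype S :=
  if n is n'.+1 then uren succn id (su n') else UVar 0.
Definition upU_g (S : comPzRingType) (sg : nat -> gtype S) (n : nat) : gtype S :=
  gren succn id (sg n).
Definition upG_u (S : comPzRingType) (su : nat -> utype S) (n : nat) : utype S :=
  uren id succn (su n).
Definition upG_g (S : comPzRingType) (sg : nat -> gtype S) (n : nat) : gtype S :=
  if n is n'.+1 then gren id succn (sg n') else GVar 0.

Fixpoint gsubst (S : comPzRingType) (su : nat -> utype S) (sg : nat -> gtype S)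
    (T : gtype S) : gtype S :=
  match T with
  | GUnit U => GUnit (usubst su sg U)
  | GScal a R => GScal a (gsubst su sg R)
  | GAdd R R' => GAdd (gsubst su sg R) (gsubst su sg R')
  | GVar n => sg n
  end
with usubst (S : comPzRingType) (su : nat -> utype S) (sg : nat -> gtype S)
    (U : utype S) : utype S :=
  match U with
  | UVar n => su n
  | UArr V T => UArr (usubst su sg V) (gsubst su sg T)
  | UAllU V => UAllU (usubst (upU_u su) (upU_g sg) V)
  | UAllG V => UAllG (usubst (upG_u su) (upG_g sg) V)
  end.

(* The kind of a type variable, and the types that may be substituted for a
   variable of each kind. *)
Inductive kind : Type := KUnit | KGen.

Inductive tyarg (S : comPzRingType) : Type :=
| ArgU of utype S
| ArgG of gtype S.

Definition kind_of (S : comPzRingType) (A : tyarg S) : kind :=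
  if A is ArgU _ then KUnit else KGen.

Definition uall (S : comPzRingType) (k : kind) (U : utype S) : utype S :=
  if k is KUnit then UAllU U else UAllG U.

(* forall X1 ... Xp. U, with the kinds of X1, ..., Xp listed in [ks]. *)
Definition ualls (S : comPzRingType) (ks : seq kind) (U : utype S) : utype S :=
  foldr (@uall S) U ks.

Definition args_u (S : comPzRingType) (A : seq (tyarg S)) : seq (utype S) :=
  pmap (fun x => if x is ArgU U then Some U else None) (rev A).
Definition args_g (S : comPzRingType) (A : seq (tyarg S)) : seq (gtype S) :=
  pmap (fun x => if x is ArgG T then Some T else None) (rev A).

Definition inst_u (S : comPzRingType) (A : seq (tyarg S)) (n : nat) : utype S :=
  nth (UVar (n - size (args_u A))%N) (args_u A) n.
Definition inst_g (S : comPzRingType) (A : seq (tyarg S)) (n : nat) : gtype S :=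
  nth (GVar (n - size (args_g A))%N) (args_g A) n.

(* T[A1/X1, ..., Ap/Xp] (simultaneously), where X1, ..., Xp are the variables
   bound by [ualls] of the kinds of A1, ..., Ap, so that Xp is the innermost. *)
Definition ginst (S : comPzRingType) (A : seq (tyarg S)) : gtype S -> gtype S :=
  gsubst (inst_u A) (inst_g A).
Definition uinst (S : comPzRingType) (A : seq (tyarg S)) : utype S -> utype S :=
  usubst (inst_u A) (inst_g A).

Definition ushift (S : comPzRingType) (k : kind) : utype S -> utype S :=
  if k is KUnit then uren succn id else uren id succn.

Inductive teq (S : comPzRingType) : gtype S -> gtype S -> Prop :=
| teq_refl T : teq T T
| teq_sym T R : teq T R -> teq R T
| teq_trans T R Q : teq T R -> teq R Q -> teq T Q
| teq_one T : teq (GScal 1 T) T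
| teq_scal_scal a b T : teq (GScal a (GScal b T)) (GScal (a * b) T)
| teq_scal_add a T R : teq (GAdd (GScal a T) (GScal a R)) (GScal a (GAdd T R))
| teq_factor a b T : teq (GAdd (GScal a T) (GScal b T)) (GScal (a + b) T)
| teq_addC T R : teq (GAdd T R) (GAdd R T)
| teq_addA T R Q : teq (GAdd T (GAdd R Q)) (GAdd (GAdd T R) Q)
| teq_Scal a T T' : teq T T' -> teq (GScal a T) (GScal a T')
| teq_Add T T' R R' : teq T T' -> teq R R' -> teq (GAdd T R) (GAdd T' R')
| teq_Arr U U' T T' : teq (GUnit U) (GUnit U') -> teq T T' ->
    teq (GUnit (UArr U T)) (GUnit (UArr U' T'))
| teq_All k U U' : teq (GUnit U) (GUnit U') ->
    teq (GUnit (uall k U)) (GUnit (uall k U')).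

(* The i-th entry of a context is the type of the variable of index i. In
   [ty_allI], shifting the context expresses that the generalized variable,
   which has index 0 in the premise, is not free in it. [ty_ac] is not a rule of
   its own: it says that the subject of a judgement is a term modulo [ac]. *)
Inductive typed (S : comPzRingType) :
    seq (utype S) -> term S -> gtype S -> Prop :=
| ty_ax G x U : onth G x = Some U -> typed G (Var x) (GUnit U)
| ty_equiv G t T R : typed G t T -> teq R T -> typed G t R
| ty_arrI G t U T : typed (U :: G) t T -> typed G (Lam t) (GUnit (UArr U T))
| ty_arrE G t r n m (ks : seq kind) (U : utype S)
    (a : 'I_n.+1 -> S) (T : 'I_n.+1 -> gtype S)
    (b : 'I_m.+1 -> S) (A : 'I_m.+1 -> seq (tyarg S)) :
    (forall j, [seq kind_of x | x <- A j] = ks) ->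
    typed G t (sum1 (@GAdd S)
      (fun i => GScal (a i) (GUnit (ualls ks (UArr U (T i)))))) ->
    typed G r (sum1 (@GAdd S)
      (fun j => GScal (b j) (GUnit (uinst (A j) U)))) ->
    typed G (App t r) (sum1 (@GAdd S) (fun i => sum1 (@GAdd S)
      (fun j => GScal (a i * b j) (ginst (A j) (T i)))))
| ty_allI G t n k (a : 'I_n.+1 -> S) (U : 'I_n.+1 -> utype S) :
    typed [seq ushift k V | V <- G] t
      (sum1 (@GAdd S) (fun i => GScal (a i) (GUnit (U i)))) ->
    typed G t (sum1 (@GAdd S) (fun i => GScal (a i) (GUnit (uall k (U i)))))
| ty_allE G t n (a : 'I_n.+1 -> S) (U : 'I_n.+1 -> utype S) (A : tyarg S) :
    typed G t
      (sum1 (@GAdd S) (fun i => GScal (a i) (GUnit (uall (kind_of A) (U i))))) ->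
    typed G t (sum1 (@GAdd S) (fun i => GScal (a i) (GUnit (uinst [:: A] (U i)))))
| ty_addI G t r T R : typed G t T -> typed G r R ->
    typed G (Add t r) (GAdd T R)
| ty_oneE G t T : typed G (Scal 1 t) T -> typed G t T
| ty_S G t n (a : 'I_n.+1 -> S) (T : 'I_n.+1 -> gtype S) :
    (forall i, typed G t (T i)) ->
    typed G (Scal (\sum_i a i) t)
      (sum1 (@GAdd S) (fun i => GScal (a i) (T i)))
| ty_ac G t t' T : ac t t' -> typed G t T -> typed G t' T.

(* Sums of m+1 pairwise distinct abstractions (distinct as terms modulo [ac]) of
   which the first n carry a scalar; n = 0 and n = m+1 are allowed. *)
Definition values (S : comPzRingType) (t : term S) : Prop :=
  exists (n m : nat) (a : 'I_m.+1 -> S) (b : 'I_m.+1 -> term S),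
    [/\ (n <= m.+1)%N,
        forall i j, i != j -> ~ ac (Lam (b i)) (Lam (b j)) &
        ac t (sum1 (@Add S)
          (fun i => if (i < n)%N then Scal (a i) (Lam (b i)) else Lam (b i)))].

(* Main.v *)
(** Typing is needed only to know that [t] is closed.  In a closed normal term an
    application cannot survive: both of its sides are normal sums of possibly
    scaled abstractions, a sum or a scalar on either side would distribute, and
    two abstractions form a beta-redex.  Hence a closed normal term is a sum of
    possibly scaled abstractions, and two equal abstractions in it would be
    factored together. *)
Require Import Defs.
From mathcomp Require Import all_boot all_algebra.

Set Implicit Arguments.
Unset Strict Implicit.
Unset Printing Implicit Defensive.

Local Open Scope ring_scope.

Section ClosedTerms.
Variable S : comPzRingType.
Implicit Types t u : term S.

Fixpoint closed_at (n : nat) t : bool :=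
  match t with
  | Var x => (x < n)%N
  | Lam u => closed_at n.+1 u
  | App u v | Add u v => closed_at n u && closed_at n v
  | Scal _ u => closed_at n u
  end.

Lemma closed_at_ac t u : ac t u -> forall n, closed_at n t = closed_at n u.
Proof.
elim=> {t u} //=.
- by move=> t u v _ IHt _ IHu n; rewrite IHt.
- by move=> t u n; rewrite andbC.
- by move=> t u v n; rewrite andbA.
- by move=> t t' u u' _ IHt _ IHu n; rewrite IHt IHu.
- by move=> t t' u u' _ IHt _ IHu n; rewrite IHt IHu.
Qed.

Lemma typed_closed (G : seq (utype S)) t (T : gtype S) :
  typed G t T -> closed_at (size G) t.
Proof.
elim=> {G t T} //=.
- by move=> G x U GxU; rewrite ltnNge; apply/negP => /onth_default; rewrite GxU.
- by move=> G t r n m ks U a T b A _ _ -> _ ->.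
- by move=> G t n k a U _; rewrite size_map.
- by move=> G t r T R _ -> _ ->.
(* The index type ['I_n.+1] is inhabited, so [ty_S] always has a premise about [t]. *)
- by move=> G t n a T _ /(_ ord0).
- by move=> G t t' T tt' _; rewrite (closed_at_ac tt').
Qed.

End ClosedTerms.

Section NormalForms.
Variable S : comPzRingType.
Implicit Types t u v : term S.

Lemma red_step t u : step t u -> red t u.
Proof. by move=> tu; exists t, u; split=> //; apply: ac_refl. Qed.

Lemma red_acl t u v : ac t u -> red u v -> red t v.
Proof.
by move=> tu [s [s' [us ss' s'v]]]; exists s, s'; split=> //; apply: ac_trans us.
Qed.

Lemma red_Scal a t u : red t u -> red (Scal a t) (Scal a u).
Proof.
move=> [s [s' [ts ss' s'u]]]; exists (Scal a s), (Scal a s').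
by split; [apply: ac_Scal | apply: step_ctx_scal | apply: ac_Scal].
Qed.

Lemma red_Addr v t u : red t u -> red (Add v t) (Add v u).
Proof.
move=> [s [s' [ts ss' s'u]]]; exists (Add v s), (Add v s').
by split; [apply: ac_Add ts; apply: ac_refl | apply: step_ctx_add
  | apply: ac_Add s'u; apply: ac_refl].
Qed.

(** [step] enters only the right summand; the left one is reached through commutativity, which [red]
    absorbs. *)
Lemma red_Addl v t u : red t u -> red (Add t v) (Add v u).
Proof. by move=> tu; apply: red_acl (ac_addC _ _) (red_Addr _ tu). Qed.

Lemma red_Appr v t u : red t u -> red (App v t) (App v u).
Proof.
move=> [s [s' [ts ss' s'u]]]; exists (App v s), (App v s').
by split; [apply: ac_App ts; apply: ac_refl | apply: step_ctx_appr
  | apply: ac_App s'u; apply: ac_refl].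
Qed.

Lemma red_Appl v t u : red t u -> red (App t v) (App u v).
Proof.
move=> [s [s' [ts ss' s'u]]]; exists (App s v), (App s' v).
by split; [apply: ac_App ts (ac_refl _) | apply: step_ctx_appl
  | apply: ac_App s'u (ac_refl _)].
Qed.

Lemma normal_form_sub t t' :
  (forall u, red t u -> exists v, red t' v) -> normal_form t' -> normal_form t.
Proof. by move=> redt nft' [u /redt]. Qed.

(** The syntactic core of [values]: distinctness is dropped, and scaled and bare leaves may be mixed
    and bracketed in any way. *)
Fixpoint lam_comb t : bool :=
  match t with
  | Lam _ | Scal _ (Lam _) => true
  | Add u v => lam_comb u && lam_comb v
  | _ => false
  end.

Lemma normal_closed_lam_comb t : closed_at 0 t -> normal_form t -> lam_comb t.
Proof.
(* An abstraction is accepted whatever its body, so the induction never goes under a binder and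
   closedness at level 0 suffices. *)
elim: t => [//|//|t IHt r IHr|a t IHt|t IHt r IHr] /=.
- case/andP=> clt clr nf.
  have {IHt clt} lt : lam_comb t.
    apply: IHt => //; apply: normal_form_sub nf => u tu.
    by exists (App u r); apply: red_Appl.
  have {IHr clr} lr : lam_comb r.
    apply: IHr => //; apply: normal_form_sub nf => u ru.
    by exists (App t u); apply: red_Appr.
  exfalso; apply: nf; case: t lt => [//|t|//|a t|t1 t2] _.
  + case: r lr => [//|r|//|b r|r1 r2] _; eexists; apply: red_step.
    * exact: step_beta.
    * exact: step_app_scalr.
    * exact: step_app_addr.
  + by eexists; apply/red_step/step_app_scall.
  + by eexists; apply/red_step/step_app_addl.
- move=> clt nf.
  have {IHt clt} lt : lam_comb t.
    apply: IHt => //; apply: normal_form_sub nf => u tu.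
    by exists (Scal a u); apply: red_Scal.
  (* Only an abstraction can stand below the scalar: a second scalar would be multiplied in, a sum
     distributed over. *)
  case: t lt nf => [//|//|//|b t|t1 t2] _ nf; exfalso; apply: nf.
  + by eexists; apply/red_step/step_scal_scal.
  + by eexists; apply/red_step/step_scal_add.
- case/andP=> clt clr nf; apply/andP; split.
  + apply: IHt => //; apply: normal_form_sub nf => u tu.
    by exists (Add r u); apply: red_Addl.
  + apply: IHr => //; apply: normal_form_sub nf => u ru.
    by exists (Add t u); apply: red_Addr.
Qed.

Lemma ac_sum1 n (F G : 'I_n.+1 -> term S) :
  (forall i, ac (F i) (G i)) -> ac (sum1 (@Add S) F) (sum1 (@Add S) G).
Proof.
elim: n F G => [|n IHn] F G FG /=; first exact: FG.
by apply: ac_Add (FG _) (IHn _ _ _) => i; apply: FG.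
Qed.

Lemma eq_ac t u : t = u -> ac t u.
Proof. by move->; apply: ac_refl. Qed.

Lemma ac_addCA t u v : ac (Add t (Add u v)) (Add u (Add t v)).
Proof.
apply: ac_trans (ac_addA _ _ _) _; apply: ac_trans (ac_sym (ac_addA _ _ _)).
exact: ac_Add (ac_addC _ _) (ac_refl _).
Qed.

(** By induction: the summand moves to the front of the tail, then trades places with the first
    one. *)
Lemma ac_sum1D1 n (F : 'I_n.+2 -> term S) i :
  ac (sum1 (@Add S) F)
     (Add (F i) (sum1 (@Add S) (fun k : 'I_n.+1 => F (lift i k)))).
Proof.
have lift_lift0 m (j : 'I_m.+1) : lift (lift ord0 j) ord0 = ord0.
  exact: val_inj.
elim: n F i => [|n IHn] F i; case: (unliftP ord0 i) => [j|] -> /=;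
  try exact: ac_refl.
- rewrite lift_lift0 [j]ord1; exact: ac_addC.
- rewrite lift_lift0.
  apply: ac_trans (ac_Add (ac_refl _) (IHn (fun k => F (lift ord0 k)) j)) _.
  apply: ac_trans (ac_addCA _ _ _) _.
  apply: ac_Add; first exact: ac_refl.
  apply: ac_Add; first exact: ac_refl.
  apply: ac_sum1 => k; apply: eq_ac.
  by congr F; apply: val_inj; rewrite /= /bump !leq0n !add1n ltnS addnS.
Qed.

Definition lam_leaf (n m : nat) (a : 'I_m -> S) (b : 'I_m -> term S) (i : 'I_m) :=
  if (i < n)%N then Scal (a i) (Lam (b i)) else Lam (b i).

(** What remains of [values] once distinctness is dropped. *)
Definition sorted_comb t : Prop :=
  exists (n m : nat) (a : 'I_m.+1 -> S) (b : 'I_m.+1 -> term S),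
    (n <= m.+1)%N /\ ac t (sum1 (@Add S) (lam_leaf n a b)).

Lemma sorted_comb_ac t u : ac t u -> sorted_comb u -> sorted_comb t.
Proof.
move=> tu [n [m [a [b [nm us]]]]]; exists n, m, a, b.
by split=> //; apply: ac_trans us.
Qed.

(** [unlift h] is [None] exactly at [h], where the new leaf sits, and recovers the old index
    elsewhere. The hypothesis says that old leaves stay scaled or bare when the threshold passes
    from [n] to [n']. *)
Lemma ac_sum1_insert n n' m (a : 'I_m.+1 -> S) (b : 'I_m.+1 -> term S)
    (h : 'I_m.+2) c u :
  (forall k : 'I_m.+1, (lift h k < n')%N = (k < n)%N) ->
  ac (Add (if (h < n')%N then Scal c (Lam u) else Lam u)
          (sum1 (@Add S) (lam_leaf n a b)))
     (sum1 (@Add S) (lam_leaf n' (fun i => oapp a c (unlift h i))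
                                 (fun i => oapp b u (unlift h i)))).
Proof.
move=> hn; apply: ac_sym; apply: ac_trans (ac_sum1D1 _ h) _.
rewrite {1}/lam_leaf unlift_none /=; apply: ac_Add; first exact: ac_refl.
by apply: ac_sum1 => k; apply: eq_ac; rewrite /lam_leaf hn liftK.
Qed.

(* A scaled leaf is inserted in front, an unscaled one at the end. *)
Lemma sorted_comb_Add t : lam_comb t -> forall u, sorted_comb u ->
  sorted_comb (Add t u).
Proof.
elim: t => [//|t _|//|c t _|t IHt r IHr] /=.
- move=> _ u [n [m [a [b [nm us]]]]].
  (* By [nm] the index [ord_max] is not below [n], so the new leaf is bare and the scalar 1 is a
     mere default. *)
  exists n, m.+1, (fun i => oapp a 1 (unlift ord_max i)),
    (fun i => oapp b t (unlift ord_max i)).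
  split; first exact: leqW.
  apply: ac_trans (ac_Add (ac_refl _) us) _.
  have := @ac_sum1_insert n n m a b ord_max 1 t; rewrite /= ltnNge nm; apply.
  by move=> k; congr (_ < n)%N; apply: (lift_max k).
- case: t => // t _ u [n [m [a [b [nm us]]]]].
  (* The old indices and the threshold all move up by one. *)
  exists n.+1, m.+1, (fun i => oapp a c (unlift ord0 i)),
    (fun i => oapp b t (unlift ord0 i)).
  split=> //; apply: ac_trans (ac_Add (ac_refl _) us) _.
  exact: (@ac_sum1_insert n n.+1 m a b ord0 c t).
- case/andP=> lt lr u su; apply: sorted_comb_ac (ac_sym (ac_addA _ _ _)) _.
  exact/IHt/IHr.
Qed.

Lemma lam_comb_sorted t : lam_comb t -> sorted_comb t.
Proof.
elim: t => [//|t _|//|c t _|t _ r IHr] /=.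
- move=> _; exists 0%N, 0%N, (fun=> 1), (fun=> t); split=> //; exact: ac_refl.
- case: t => // t _; exists 1%N, 0%N, (fun=> c), (fun=> t).
  by split=> //; apply: ac_refl.
- by case/andP=> lt lr; apply: sorted_comb_Add lt _ (IHr lr).
Qed.

(** Modulo [ac] the two abstractions can be made syntactically equal, and each combination of scaled
    and bare leaves then matches a factorization rule. *)
Lemma red_leaf_pair n m (a : 'I_m -> S) (b : 'I_m -> term S) i j :
  ac (Lam (b i)) (Lam (b j)) ->
  exists v, red (Add (lam_leaf n a b i) (lam_leaf n a b j)) v.
Proof.
rewrite /lam_leaf; set l := Lam (b i); set l' := Lam (b j) => ll'.
case: ifP => _; case: ifP => _; eexists.
- apply: red_acl (red_step (step_factor (a i) (a j) l')).
  exact: ac_Add (ac_Scal _ ll') (ac_refl _).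
- apply: red_acl (red_step (step_factor1 (a i) l')).
  exact: ac_Add (ac_Scal _ ll') (ac_refl _).
- apply: red_acl (red_step (step_factor1 (a j) l')).
  exact: ac_trans (ac_addC _ _) (ac_Add (ac_refl _) ll').
- apply: red_acl (red_step (step_factor11 l')).
  exact: ac_Add ll' (ac_refl _).
Qed.

(** As [red] works modulo [ac], the two summands can be brought side by side at the front by
    extracting them one after the other. *)
Lemma red_sum1_pair m (F : 'I_m.+1 -> term S) i j v :
  i != j -> red (Add (F i) (F j)) v -> exists w, red (sum1 (@Add S) F) w.
Proof.
case: m F i j => [|m] F i j; first by rewrite [i]ord1 [j]ord1.
case/unlift_some=> k -> _ {j}.
case: m F i k => [|m] F i k redFv.
  by exists v; apply: red_acl (ac_sum1D1 F i) _; rewrite [k]ord1 in redFv.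
eexists; apply: red_acl _ (red_Addl _ redFv).
apply: ac_trans (ac_sum1D1 F i) _; apply: ac_trans (ac_addA _ _ _).
exact: ac_Add (ac_refl _) (ac_sum1D1 _ k).
Qed.

End NormalForms.

Theorem theorem2 (S : comPzRingType) (t : term S) (T : gtype S) :
  typed [::] t T -> normal_form t -> values t.
Proof.
move=> /typed_closed clt nf.
have [n [m [a [b [nm ts]]]]] := lam_comb_sorted (normal_closed_lam_comb clt nf).
exists n, m, a, b; split=> // i j ij bij.
have [v redv] := red_leaf_pair n a bij.
have [w redw] := red_sum1_pair ij redv.
by apply: nf; exists w; apply: red_acl ts redw.
Qed.
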